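(* Let $F,S\in\mathcal{C}(I,\mathcal{K}_c(\mathbb{R}))$ satisfy $S(u_1)-F(u_1)=S(u_N)-F(u_N)$, let $\alpha\in(-1,1)$, and let $F^\alpha$ be the corresponding $\alpha$-fractal function. For $j\in J$ let $W_j:I\times\mathcal{K}_c(\mathbb{R})\to I\times\mathcal{K}_c(\mathbb{R})$, $W_j(u,A)=(L_j(u),\alpha A+F(L_j(u))-\alpha S(u))$. Suppose that $$r_iD_{\mathcal{G}}((u,A),(w,B))\le D_{\mathcal{G}}(W_i(u,A),W_i(w,B))\le R_iD_{\mathcal{G}}((u,A),(w,B))$$ for every $(u,A),(w,B)\in I\times\mathcal{K}_c(\mathbb{R})$, where $0<r_i\le R_i<1$ for all $i\in J$. Then $t_*\le\dim_H(\mathcal{G}(F^\alpha))\le t^*$, where $t_*$ and $t^*$ are determined by $\sum_{i=1}^{N-1}r_i^{t_*}=1$ and $\sum_{i=1}^{N-1}R_i^{t^*}=1$, respectively.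
   Context: $\mathcal{K}(\mathbb{R})$ is the collection of nonempty compact subsets of $\mathbb{R}$, with the Hausdorff metric $H_d$; $\mathcal{K}_c(\mathbb{R})$ is the subcollection of convex ones. For sets $A,B$ and $\lambda\in\mathbb{R}$: $A+B=\{a+b\}$ (Minkowski sum), $\lambda A=\{\lambda a\}$, $A-B=\{a-b:a\in A,b\in B\}$. $\mathcal{C}(I,\mathcal{K}_c(\mathbb{R}))$ is the set of continuous maps. Setting: $I=[u_1,u_N]$ with partition $\Delta: u_1<\cdots<u_N$, $J=\{1,\ldots,N-1\}$, $I_j=[u_j,u_{j+1}]$, and $L_j:I\to I_j$ is the affine contraction with $L_j(u_1)=u_j$, $L_j(u_N)=u_{j+1}$ (its ratio is $a_j=\frac{u_{j+1}-u_j}{u_N-u_1}\in(0,1)$). $F^\alpha$ is the unique continuous map with $F^{\alpha}(u)=F(u)+\alpha[F^{\alpha}(L_j^{-1}(u))-S(L_j^{-1}(u))]$ for every $u\in I_j$, $j\in J$; it takes values in $\mathcal{K}_c(\mathbb{R})$. The graph is $\mathcal{G}(F^\alpha)=\{(u,F^\alpha(u)):u\in I\}\subset I\times\mathcal{K}_c(\mathbb{R})$, and $D_{\mathcal{G}}((u,A),(w,B))=|u-w|+H_d(A,B)$. $\dim_H$ is the Hausdorff dimension with respect to $D_{\mathcal{G}}$. *)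

(* Defs.v *)
From HB Require Import structures.
From mathcomp Require Import all_boot all_order all_algebra.
From mathcomp Require Import all_classical all_reals all_analysis.

Set Implicit Arguments.
Unset Strict Implicit.
Unset Printing Implicit Defensive.

Import Order.TTheory GRing.Theory Num.Theory.
Import numFieldTopology.Exports numFieldNormedType.Exports.

Local Open Scope classical_set_scope.
Local Open Scope ring_scope.

Declare Scope kc_scope.
Delimit Scope kc_scope with KC.

Record Kc (R : realType) := MkKc {
  kc_set :> set R ;
  kc_nonempty : kc_set !=set0 ;
  kc_compact : compact kc_set ;
  kc_convex : convex_set (kc_set : set (convex_lmodType R^o)) }.
Bind Scope kc_scope with Kc.

Lemma Kc_eq (R : realType) (A B : Kc R) : A = B :> set R -> A = B.
Proof.
case: A B => [A A0 Ac Av] [B B0 Bc Bv] /= AB.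
by subst B; congr MkKc; exact: Prop_irrelevance.
Qed.

HB.instance Definition _ (R : realType) := gen_eqMixin (Kc R).
HB.instance Definition _ (R : realType) := gen_choiceMixin (Kc R).

Section minkowski.
Variable R : realType.
Implicit Types A B : set R.

Definition mink_add A B : set R := [set a + b | a in A & b in B].
Definition mink_sub A B : set R := [set a - b | a in A & b in B].
Definition mink_scale (l : R) A : set R := [set l * a | a in A].

Lemma mink_add_nonempty A B : A !=set0 -> B !=set0 -> mink_add A B !=set0.
Proof. by move=> [a Aa] [b Bb]; exists (a + b); exists a => //; exists b. Qed.

Lemma mink_sub_nonempty A B : A !=set0 -> B !=set0 -> mink_sub A B !=set0.
Proof. by move=> [a Aa] [b Bb]; exists (a - b); exists a => //; exists b. Qed.

Lemma mink_scale_nonempty l A : A !=set0 -> mink_scale l A !=set0.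
Proof. by move=> [a Aa]; exists (l * a); exists a. Qed.

Lemma mink_add_compact A B : compact A -> compact B -> compact (mink_add A B).
Proof.
move=> cA cB.
have -> : mink_add A B = (fun p : R * R => p.1 + p.2) @` (A `*` B).
  apply/seteqP; split=> x.
    by move=> [a Aa [b Bb <-]]; exists (a, b).
  by move=> [[a b] [/= Aa Bb] <-]; exists a => //; exists b.
apply: continuous_compact; last exact: compact_setX.
by apply: continuous_subspaceT => p; apply: cvgD; [exact: cvg_fst|exact: cvg_snd].
Qed.

Lemma mink_sub_compact A B : compact A -> compact B -> compact (mink_sub A B).
Proof.
move=> cA cB.
have -> : mink_sub A B = (fun p : R * R => p.1 - p.2) @` (A `*` B).
  apply/seteqP; split=> x.
    by move=> [a Aa [b Bb <-]]; exists (a, b).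
  by move=> [[a b] [/= Aa Bb] <-]; exists a => //; exists b.
apply: continuous_compact; last exact: compact_setX.
by apply: continuous_subspaceT => p; apply: cvgB; [exact: cvg_fst|exact: cvg_snd].
Qed.

Lemma mink_scale_compact l A : compact A -> compact (mink_scale l A).
Proof.
move=> cA; apply: continuous_compact => //.
by apply: continuous_subspaceT => p; exact: mulrl_continuous.
Qed.

Let cvx A := convex_set (A : set (convex_lmodType R^o)).

Let convE (a b : convex_lmodType R^o) (l : {i01 R}) :
  convex.conv l a b = l%:num * a + (1 - l%:num) * b :> R.
Proof. by []. Qed.

Lemma mink_add_convex A B : cvx A -> cvx B -> cvx (mink_add A B).
Proof.
move=> cA cB x y l; rewrite !inE => -[a Aa [b Bb <-]] [a' Aa' [b' Bb' <-]].
have := cA a a' l; rewrite !inE => /(_ Aa Aa') h1.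
have := cB b b' l; rewrite !inE => /(_ Bb Bb') h2.
eexists; first exact: h1; eexists; first exact: h2.
by rewrite !convE !mulrDr addrACA.
Qed.

Lemma mink_sub_convex A B : cvx A -> cvx B -> cvx (mink_sub A B).
Proof.
move=> cA cB x y l; rewrite !inE => -[a Aa [b Bb <-]] [a' Aa' [b' Bb' <-]].
have := cA a a' l; rewrite !inE => /(_ Aa Aa') h1.
have := cB b b' l; rewrite !inE => /(_ Bb Bb') h2.
eexists; first exact: h1; eexists; first exact: h2.
by rewrite !convE !mulrBr opprD addrACA.
Qed.

Lemma mink_scale_convex k A : cvx A -> cvx (mink_scale k A).
Proof.
move=> cA x y l; rewrite !inE => -[a Aa <-] [a' Aa' <-].
have := cA a a' l; rewrite !inE => /(_ Aa Aa') h1.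
eexists; first exact: h1.
by rewrite !convE mulrDr !(mulrCA k).
Qed.

End minkowski.

Definition kc_add (R : realType) (A B : Kc R) : Kc R :=
  MkKc (mink_add_nonempty (kc_nonempty A) (kc_nonempty B))
       (mink_add_compact (@kc_compact _ A) (@kc_compact _ B))
       (mink_add_convex (@kc_convex _ A) (@kc_convex _ B)).

(* The Minkowski difference {a - b}; it is not an inverse of the sum. *)
Definition kc_sub (R : realType) (A B : Kc R) : Kc R :=
  MkKc (mink_sub_nonempty (kc_nonempty A) (kc_nonempty B))
       (mink_sub_compact (@kc_compact _ A) (@kc_compact _ B))
       (mink_sub_convex (@kc_convex _ A) (@kc_convex _ B)).

Definition kc_scale (R : realType) (l : R) (A : Kc R) : Kc R :=
  MkKc (mink_scale_nonempty l (kc_nonempty A))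
       (mink_scale_compact (@kc_compact _ A))
       (mink_scale_convex (@kc_convex _ A)).

Notation "A + B" := (kc_add A B) : kc_scope.
Notation "A - B" := (kc_sub A B) : kc_scope.
Notation "l *: A" := (kc_scale l A) : kc_scope.

Section hausdorff_distance.
Variable R : realType.

Definition dist_to (x : R) (B : set R) : R := inf [set `|x - b| | b in B].

Definition excess (A B : set R) : R := sup [set dist_to a B | a in A].

Definition Hd (A B : Kc R) : R := Num.max (excess A B) (excess B A).

Implicit Types A B C : Kc R.

Let has_inf_dist x B : has_inf [set `|x - b| | b in B].
Proof.
split; first by case: (kc_nonempty B) => b Bb; exists `|x - b|; exists b.
by exists 0 => _ [b _ <-].
Qed.

Lemma dist_to_le x b B : kc_set B b -> dist_to x B <= `|x - b|.
Proof. by move=> Bb; apply: ge_inf; [case: (has_inf_dist x B)|exists b]. Qed.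

Lemma le_dist_to x B e :
  (forall b, kc_set B b -> e <= `|x - b|) -> e <= dist_to x B.
Proof.
move=> h; apply: lb_le_inf; first by case: (has_inf_dist x B).
by move=> _ [b Bb <-]; exact: h.
Qed.

Lemma dist_to_ge0 x B : 0 <= dist_to x B.
Proof. by apply: le_dist_to. Qed.

Lemma dist_to_excess a A B : kc_set A a -> dist_to a B <= excess A B.
Proof.
move=> Aa; apply: ub_le_sup; last by exists a.
have [b Bb] := kc_nonempty B.
have [M [_ hM]] := @compact_bounded R R^o A (@kc_compact _ A).
exists (M + 1 + `|b|) => _ [c Ac <-].
apply: (le_trans (dist_to_le c Bb)); apply: (le_trans (ler_normB _ _)).
by rewrite lerD2r; apply: hM => //; rewrite ltrDl.
Qed.

Lemma excess_le A B e :
  (forall a, kc_set A a -> dist_to a B <= e) -> excess A B <= e.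
Proof.
move=> h; apply: ge_sup; last by move=> _ [a Aa <-]; exact: h.
by case: (kc_nonempty A) => a Aa; exists (dist_to a B); exists a.
Qed.

Lemma excess_ge0 A B : 0 <= excess A B.
Proof.
have [a Aa] := kc_nonempty A.
exact: le_trans (dist_to_ge0 a B) (dist_to_excess B Aa).
Qed.

Lemma excess_triangle B A C : excess A C <= excess A B + excess B C.
Proof.
apply: excess_le => a Aa; rewrite -lerBlDr.
apply: le_trans (dist_to_excess B Aa); apply: le_dist_to => b Bb.
rewrite lerBlDr -lerBlDl; apply: le_trans (dist_to_excess C Bb).
apply: le_dist_to => c Cc; rewrite lerBlDl.
by apply: le_trans (dist_to_le a Cc) _; exact: ler_distD.
Qed.

Lemma excess0_sub A B : excess A B = 0 -> A `<=` B.
Proof.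
move=> AB a Aa; have dB : dist_to a B <= 0 by rewrite -AB dist_to_excess.
have clB : closed B by apply: compact_closed; [exact: Rhausdorff|exact: kc_compact].
apply: clB => V /nbhs_ballP[e /= e0 eV].
have [_ [b Bb <-] ab] := inf_adherent e0 (has_inf_dist a B).
exists b; split=> //; apply: eV; rewrite /ball/=.
by apply: lt_le_trans ab _; rewrite gerDr.
Qed.

Lemma excessxx A : excess A A = 0.
Proof.
apply/eqP; rewrite eq_le excess_ge0 andbT; apply: excess_le => a Aa.
by apply: le_trans (dist_to_le a Aa) _; rewrite subrr normr0.
Qed.

Lemma Hdxx A : Hd A A = 0.
Proof. by rewrite /Hd excessxx maxxx. Qed.

Lemma Hd_sym A B : Hd A B = Hd B A.
Proof. by rewrite /Hd maxC. Qed.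

Lemma Hd_ge0 A B : 0 <= Hd A B.
Proof. by rewrite /Hd le_max excess_ge0. Qed.

Lemma Hd_positivity A B : Hd A B = 0 -> A = B.
Proof.
move=> h; apply: Kc_eq; apply/seteqP; split; apply: excess0_sub;
  apply/eqP; rewrite eq_le excess_ge0 andbT -h /Hd le_max lexx ?orbT//.
Qed.

Lemma Hd_triangle B A C : Hd A C <= Hd A B + Hd B C.
Proof.
rewrite {1}/Hd ge_max; apply/andP; split.
  by apply: le_trans (excess_triangle B A C) _; rewrite lerD// /Hd le_max lexx.
apply: le_trans (excess_triangle B C A) _.
by rewrite addrC lerD// /Hd le_max lexx orbT.
Qed.

End hausdorff_distance.

HB.instance Definition _ (R : realType) :=
  isMetric.Build R (Kc R) (@Hdxx R) (@Hd_positivity R) (@Hd_sym R)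
    (@Hd_triangle R).

(* An alias of the product, so that its metric is the sum metric D_G and not
   the max metric that the product carries by default. *)
Definition graph_space (R : realType) : Type := (R * Kc R)%type.

Definition D_G (R : realType) (p q : graph_space R) : R :=
  `|p.1 - q.1| + Hd p.2 q.2.

Section graph_space_metric.
Variable R : realType.
Implicit Types p q s : graph_space R.

Lemma D_Gxx p : D_G p p = 0.
Proof. by rewrite /D_G subrr normr0 Hdxx addr0. Qed.

Lemma D_G_sym p q : D_G p q = D_G q p.
Proof. by rewrite /D_G distrC Hd_sym. Qed.

Lemma D_G_positivity p q : D_G p q = 0 -> p = q.
Proof.
case: p q => [x A] [y B]; rewrite /D_G/= => /eqP.
rewrite paddr_eq0 ?normr_ge0 ?Hd_ge0// normr_eq0 subr_eq0.
by move=> /andP[/eqP -> /eqP /Hd_positivity ->].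
Qed.

Lemma D_G_triangle q p s : D_G p s <= D_G p q + D_G q s.
Proof. by rewrite /D_G addrACA lerD ?ler_distD ?Hd_triangle. Qed.

HB.instance Definition _ := Choice.copy (graph_space R) (R * Kc R)%type.
HB.instance Definition _ :=
  isMetric.Build R (graph_space R) D_Gxx D_G_positivity D_G_sym D_G_triangle.

End graph_space_metric.

Section hausdorff_dimension.
Variables (R : realType) (T : metricType R).
Implicit Types A U : set T.
Local Open Scope ereal_scope.

Definition diam U : \bar R := ereal_sup [set (mdist x y)%:E | x in U & y in U].

(* |U|^s with the usual conventions: 0 for U empty (whatever s), and 0^0 = 1
   for nonempty U. *)
Definition diam_pow (s : R) U : \bar R :=
  if `[< U = set0 >] then 0 else diam U `^ s.

Definition hausdorff_premeasure (s delta : R) A : \bar R :=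
  ereal_inf [set \sum_(0 <= k <oo) diam_pow s (U k) | U in
    [set U : (set T)^nat |
      A `<=` \bigcup_k U k /\ forall k, diam (U k) <= delta%:E]].

Definition hausdorff_measure (s : R) A : \bar R :=
  ereal_sup [set hausdorff_premeasure s delta A | delta in
    [set delta : R | (0 < delta)%R]].

Definition hausdorff_dim A : \bar R :=
  ereal_inf [set s%:E | s in
    [set s : R | (0 <= s)%R /\ hausdorff_measure s A = 0]].

End hausdorff_dimension.

(* The nodes are u 1, ..., u N (other values of u play no role), and the
   index set J is {j | 1 <= j < N}. *)
Section fractal_function.
Variables (R : realType) (N : nat) (u : nat -> R).

Definition is_partition : Prop :=
  forall j, (1 <= j < N)%N -> u j < u j.+1.

Definition ratio (j : nat) : R := (u j.+1 - u j) / (u N - u 1%N).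

Definition L (j : nat) (x : R) : R := u j + ratio j * (x - u 1%N).

Definition Linv (j : nat) (y : R) : R := u 1%N + (y - u j) / ratio j.

Lemma partition_lt i j : is_partition -> (1 <= i)%N -> (i < j)%N ->
  (j <= N)%N -> u i < u j.
Proof.
move=> hu i1; elim: j => // j IH; rewrite ltnS leq_eqVlt => /orP[/eqP <-|ij] jN.
  by apply: hu; rewrite i1.
apply: lt_trans (IH ij (ltnW jN)) _; apply: hu.
by rewrite jN andbT (leq_trans i1 (ltnW ij)).
Qed.

Lemma ratio_gt0 j : is_partition -> (1 <= j < N)%N -> 0 < ratio j.
Proof.
move=> hu jN; have /andP[j1 jN'] := jN.
rewrite divr_gt0// subr_gt0; first exact: hu.
by apply: partition_lt => //; exact: leq_ltn_trans j1 jN'.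
Qed.

Lemma L_first j : L j (u 1%N) = u j.
Proof. by rewrite /L subrr mulr0 addr0. Qed.

Lemma L_last j : is_partition -> (1 < N)%N -> L j (u N) = u j.+1.
Proof.
move=> hu N1; rewrite /L /ratio divfK ?subrKC// subr_eq0 gt_eqF//.
exact: partition_lt.
Qed.

Lemma LK j : is_partition -> (1 <= j < N)%N -> cancel (L j) (Linv j).
Proof.
move=> hu jN x; have r0 := ratio_gt0 hu jN.
by rewrite /L /Linv [u j + _]addrC addrK mulrC mulKf ?gt_eqF// subrKC.
Qed.

Lemma LinvK j : is_partition -> (1 <= j < N)%N -> cancel (Linv j) (L j).
Proof.
move=> hu jN x; have r0 := ratio_gt0 hu jN.
by rewrite /L /Linv [u 1%N + _]addrC addrK mulrC divfK ?gt_eqF// subrKC.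
Qed.

Definition is_fractal_function (F S : R -> Kc R) (alpha : R)
    (Fa : R -> Kc R) : Prop :=
  {within `[u 1%N, u N], continuous Fa} /\
  forall j, (1 <= j < N)%N -> forall x, x \in `[u j, u j.+1] ->
    Fa x = (F x + alpha *: (Fa (Linv j x) - S (Linv j x)))%KC.

Definition W (F S : R -> Kc R) (alpha : R) (j : nat) (p : graph_space R) :
    graph_space R :=
  (L j p.1, (alpha *: p.2 + F (L j p.1) - alpha *: S p.1)%KC).

Definition graph (Fa : R -> Kc R) : set (graph_space R) :=
  [set (x, Fa x) | x in `[u 1%N, u N]].

End fractal_function.

(* Main.v *)
Require Import Defs.
From HB Require Import structures.
From mathcomp Require Import all_boot all_order all_algebra.
From mathcomp Require Import all_classical all_reals all_analysis.
From mathcomp Require Import ring lra.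

Set Implicit Arguments.
Unset Strict Implicit.
Unset Printing Implicit Defensive.

Import Order.TTheory GRing.Theory Num.Theory.
Import numFieldTopology.Exports numFieldNormedType.Exports.

Local Open Scope classical_set_scope.
Local Open Scope ring_scope.

(** The two sides of the dimension estimate are of different nature.

    Lower bound.  The graph projects onto the interval [u 1, u N] by the first
    coordinate, which is 1-Lipschitz for [D_G], so its dimension is at least 1
    ([hausdorff_dim_ge1]).  On the other hand the lower Lipschitz constant of
    [W i] is at most the ratio of [L i] ([lower_ratio_le]): since the Minkowski sum is commutative, one can
    choose sets over the two ends of the interval that [W i] sends to one and
    the same set, and then only the first coordinates contribute to the distance
    of the images.  The ratios add up to 1 and [t |-> \sum r i `^ t] is strictly
    decreasing, so the similarity exponent [tlow] is at most 1.

    Upper bound.  The functional equation of the fractal function says that the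
    graph is covered by its images under the maps [W i] ([graph_self_similar]).
    It is bounded ([graph_bounded]), so iterating this covering yields, for each
    [n], a finite cover by the images of the graph along the words of length
    [n], whose diameters are at most [d] times the product of the [rho i] along
    the word.  The sum of their [s]-th powers is
    [(\sum rho i `^ s) ^+ n * d `^ s], which tends to 0 when [s > tup].  This is
    [attractor_hausdorff_measure0]. *)

(** * Monotonicity in the exponent *)

Lemma powR_lt1_decr (R : realType) (a s t : R) :
  0 < a < 1 -> s < t -> a `^ t < a `^ s.
Proof.
move=> /andP[a0 a1] st.
rewrite -(subrK s t) powRD ?(gt_eqF a0) ?implybT// gtr_pMl ?powR_gt0//.
have -> : 1 = 1 `^ (t - s) :> R by rewrite powR1.
by rewrite gt0_ltr_powR ?subr_gt0 ?nnegrE ?ltW.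
Qed.

Lemma sum_powR_decr (R : realType) (N : nat) (a : nat -> R) (s t : R) :
  (2 <= N)%N -> (forall i, (1 <= i < N)%N -> 0 < a i < 1) -> s < t ->
  \sum_(1 <= i < N) a i `^ t < \sum_(1 <= i < N) a i `^ s.
Proof.
move=> N2 a01 st; apply: ltr_sum_nat => // i iN.
by apply: powR_lt1_decr => //; exact: a01.
Qed.

(** * Hausdorff measure: covers and Lipschitz images *)

Section covers.
Variables (R : realType) (T : metricType R).
Implicit Types (A U : set T) (s d : R).

Lemma diam_pow_ge0 s U : (0 <= diam_pow s U)%E.
Proof. by rewrite /diam_pow; case: asboolP => // _; exact: poweR_ge0. Qed.

Lemma hausdorff_premeasure_ge0 s d A : (0 <= hausdorff_premeasure s d A)%E.
Proof.
apply: le_ereal_inf_tmp => _ [U _ <-].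
by apply: nneseries_ge0 => k _ _; exact: diam_pow_ge0.
Qed.

Lemma diam_le d U : (forall x y, U x -> U y -> mdist x y <= d) ->
  (diam U <= d%:E)%E.
Proof.
by move=> Ud; apply: ge_ereal_sup => _ [x Ux [y Uy <-]]; rewrite lee_fin Ud.
Qed.

Lemma le_diam x y U : U x -> U y -> ((mdist x y)%:E <= diam U)%E.
Proof. by move=> Ux Uy; apply: ereal_sup_ubound; exists x => //; exists y. Qed.

Lemma diam_ge0 U : U !=set0 -> (0 <= diam U)%E.
Proof. by move=> [x Ux]; have := le_diam Ux Ux; rewrite mdistxx. Qed.

(** An upper bound on the distances in [U] bounds [diam_pow] even when [U] is
    empty or [s = 0], the two cases that depend on a convention. *)
Lemma diam_pow_le s d U : 0 <= s -> 0 <= d ->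
  (forall x y, U x -> U y -> mdist x y <= d) -> (diam_pow s U <= (d `^ s)%:E)%E.
Proof.
move=> s0 d0 Ud; rewrite /diam_pow; case: asboolP => [_|/eqP/set0P U0].
  by rewrite lee_fin powR_ge0.
rewrite -poweR_EFin gt0_ler_poweR// ?in_itv/= ?leey ?andbT ?diam_ge0 ?lee_fin//.
exact: diam_le.
Qed.

(** A finite cover is padded with empty sets, which contribute 0 to the sum for
    every exponent, to a cover by a sequence. *)
Lemma hausdorff_premeasure_fin_cover (I : finType) (U : I -> set T) (d : I -> R)
    s delta A : 0 <= s -> 0 <= delta ->
  (forall i, 0 <= d i <= delta) ->
  (forall i x y, U i x -> U i y -> mdist x y <= d i) ->
  A `<=` \bigcup_i U i ->
  (hausdorff_premeasure s delta A <= (\sum_i d i `^ s)%:E)%E.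
Proof.
move=> s0 delta0 dd Ud AU.
pose V k := if insub k is Some o then U (@enum_val I I o) else set0.
have VE (o : 'I_#|I|) : V o = U (enum_val o) by rewrite /V valK.
have V0 k : (#|I| <= k)%N -> V k = set0.
  by move=> Ik; rewrite /V insubN// -leqNgt.
apply: ge_ereal_inf; exists (\sum_(0 <= k <oo) diam_pow s (V k))%E.
  exists V => //; split=> [x /AU[i _ Uix]|k].
    by exists (enum_rank i) => //; rewrite VE enum_rankK.
  apply: diam_le => x y; case: (ltnP k #|I|) => [kI|/V0 ->//].
  rewrite (VE (Ordinal kI)) => Ux Uy.
  apply: (le_trans (Ud _ _ _ Ux Uy)).
  by case/andP: (dd (enum_val (Ordinal kI))).
rewrite (nneseries_split 0 #|I|); last by move=> k _; exact: diam_pow_ge0.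
rewrite [X in (_ + X)%E]eseries0; last first.
  by move=> k Ik _; rewrite V0// /diam_pow; case: asboolP.
rewrite adde0 add0n big_mkord -sumEFin (reindex _ (onW_bij _ (@enum_val_bij I))).
apply: lee_sum => o _; rewrite VE; apply: diam_pow_le => //.
- by case/andP: (dd (enum_val o)).
- exact: Ud.
Qed.

(** The sets of the cover are the images of [A] along the words of length [n],
    intersected with [A] at each stage so that the Lipschitz condition on [A]
    applies.  The index type is left existential because only the sum of the
    powers of the bounds [e] matters later: summing over the first letter and
    the remaining word factors out [\sum_j rho j `^ s]. *)
Lemma attractor_covers (J : finType) (f : J -> T -> T) (rho : J -> R) (q d s : R)
    A n : 0 <= d ->
  (forall x y, A x -> A y -> mdist x y <= d) ->
  (forall j, 0 <= rho j <= q) ->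
  (forall j x y, A x -> A y -> mdist (f j x) (f j y) <= rho j * mdist x y) ->
  A `<=` \bigcup_j (f j @` A) ->
  exists (I : finType) (U : I -> set T) (e : I -> R),
    [/\ forall i, 0 <= e i <= q ^+ n * d,
        forall i x y, U i x -> U i y -> mdist x y <= e i,
        A `<=` \bigcup_i U i &
        \sum_i e i `^ s = (\sum_j rho j `^ s) ^+ n * d `^ s].
Proof.
move=> d0 Ad rhoq lipf Af; elim: n => [|n [I [U [e [eq Ue AU sume]]]]].
  exists unit, (fun=> A), (fun=> d); split.
  - by move=> _; rewrite d0 expr0 mul1r lexx.
  - by move=> _; exact: Ad.
  - by move=> x Ax; exists tt.
  - by rewrite expr0 mul1r big_const card_unit/= addr0.
exists (J * I)%type, (fun p => f p.1 @` (A `&` U p.2)),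
  (fun p => rho p.1 * e p.2); split.
- move=> [j i]/=; have /andP[r0 rq] := rhoq j; have /andP[e0 eq'] := eq i.
  by rewrite mulr_ge0//= exprS -mulrA ler_pM.
- move=> [j i] _ _ /= [x [Ax Ux] <-] [y [Ay Uy] <-].
  apply: (le_trans (lipf _ _ _ Ax Ay)); rewrite ler_wpM2l ?Ue//.
  by case/andP: (rhoq j).
- move=> _ /Af[j _ [x Ax <-]]; have [i _ Uix] := AU _ Ax.
  by exists (j, i) => //=; exists x.
- rewrite exprS -mulrA -sume big_distrl/= -(pair_bigA _ (fun j i =>
    (rho j * e i) `^ s))/=.
  apply: eq_bigr => j _; rewrite big_distrr/=; apply: eq_bigr => i _.
  by rewrite powRM//; [case/andP: (rhoq j)|case/andP: (eq i)].
Qed.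

(** Both the mesh [q ^+ n * d] and the sum [c ^+ n * d `^ s] of the covers of
    [attractor_covers] tend to 0, the former because finitely many ratios
    below 1 have a maximum [q] below 1. *)
Lemma attractor_hausdorff_measure0 (J : finType) (f : J -> T -> T)
    (rho : J -> R) (d s : R) A : 0 <= s -> 0 <= d ->
  (forall x y, A x -> A y -> mdist x y <= d) ->
  (forall j, 0 <= rho j < 1) ->
  (forall j x y, A x -> A y -> mdist (f j x) (f j y) <= rho j * mdist x y) ->
  A `<=` \bigcup_j (f j @` A) ->
  \sum_j rho j `^ s < 1 ->
  hausdorff_measure s A = 0%E.
Proof.
move=> s0 d0 Ad rho1 lipf Af c1.
pose q := \big[Num.max/0]_j rho j.
have q0 : 0 <= q by apply: bigmax_ge_id.
have q1 : q < 1 by apply/bigmax_ltP; split=> // j _; case/andP: (rho1 j).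
have rhoq j : 0 <= rho j <= q.
  by case/andP: (rho1 j) => -> _ /=; exact: le_bigmax.
set c := \sum_j _ in c1.
have c0 : 0 <= c by apply: sumr_ge0 => j _; exact: powR_ge0.
apply/eqP; rewrite eq_le; apply/andP; split; last first.
  apply: le_ereal_sup_tmp; exists (hausdorff_premeasure s 1 A).
    by exists 1 => //=; exact: ltr01.
  exact: hausdorff_premeasure_ge0.
apply: ge_ereal_sup => _ [delta /= delta0 <-].
apply/lee_addgt0Pr => e e0; rewrite add0e.
have cvgM0 (z k : R) : 0 <= z -> z < 1 -> z ^+ n * k @[n --> \oo] --> 0.
  move=> z0 z1; rewrite -[0](mul0r k); apply: cvgMl.
  by apply: cvg_expr; rewrite ger0_norm.
have : \forall n \near \oo, q ^+ n * d <= delta /\ c ^+ n * d `^ s <= e.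
  near=> n; split; near: n.
  - have /cvgr0_norm_le/(_ _ delta0) := cvgM0 q d q0 q1.
    by apply: filterS => n; exact: le_trans (ler_norm _).
  - have /cvgr0_norm_le/(_ _ e0) := cvgM0 c (d `^ s) c0 c1.
    by apply: filterS => n; exact: le_trans (ler_norm _).
move=> [n _ /(_ n (leqnn _))[qn cn]].
have [I [U [g [gq Ug AU sumg]]]] :=
  attractor_covers s n d0 Ad rhoq lipf Af.
apply: (le_trans (hausdorff_premeasure_fin_cover s0 (ltW delta0) _ Ug AU)).
  by move=> i; case/andP: (gq i) => -> /le_trans ->.
by rewrite lee_fin sumg.
Unshelve. all: by end_near. Qed.

(** Diameters at most 1 only grow when raised to a power [s <= 1]; this compares
    an [s]-dimensional sum with the total length of a cover. *)
Lemma diam_le_diam_pow s U : 0 <= s <= 1 -> U !=set0 -> (diam U <= 1)%E ->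
  (diam U <= diam_pow s U)%E.
Proof.
move=> /andP[s0 s1] U0 U1; rewrite /diam_pow; case: asboolP => [U00|_].
  by move: U0; rewrite U00 => -[].
have := diam_ge0 U0; case: (diam U) U1 => [d| |]//; rewrite !lee_fin => d1.
rewrite le_eqVlt => /predU1P[<-|d0].
  exact: powR_ge0.
by rewrite ger1_powR ?d0.
Qed.

(** If the [s]-dimensional measure vanished for some [s < 1], then [A] would have
    covers of arbitrarily small total diameter; their images under [f] lie in
    intervals of arbitrarily small total length that cover [[a, b]], against the
    countable subadditivity of Lebesgue measure. *)
Lemma hausdorff_dim_ge1 (f : T -> R) (a b : R) A : a < b ->
  (forall x y, A x -> A y -> `|f x - f y| <= mdist x y) ->
  `[a, b] `<=` f @` A ->
  (1%:E <= hausdorff_dim A)%E.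
Proof.
move=> ab lipf abA; apply: le_ereal_inf_tmp => _ [s [s0 HsA] <-].
rewrite lee_fin leNgt; apply/negP => s1.
(* [U k] maps into an interval of length twice its diameter, so a sum below
   (b - a) / 4 gives a total length below (b - a) / 2. *)
have h0 : 0 < (b - a) / 4 by rewrite divr_gt0 ?subr_gt0.
have : (hausdorff_premeasure s 1 A < ((b - a) / 4)%:E)%E.
  apply: le_lt_trans (_ : 0 < _)%E; last by rewrite lte_fin.
  by rewrite -HsA; apply: ereal_sup_ubound; exists 1 => //=; exact: ltr01.
move=> /ereal_inf_lt[_ [U [AU U1] <-]]; apply/negP; rewrite -leNgt.
(* The interval is centred at the image of a chosen point of [A `&` U k]; the
   sets [U k] that miss [A] are discarded. *)
pose V k : set R := if pselect (A `&` U k !=set0) is left H then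
  let c := f (projT1 (cid H)) in let e := fine (diam (U k)) in
  [set` `[c - e, c + e]] else set0.
have Vm k : measurable (V k).
  rewrite /V; case: pselect => [H|_]; first exact: measurable_itv.
  exact: measurable0.
have fin k : A `&` U k !=set0 -> diam (U k) \is a fin_num.
  move=> [x [_ Ux]]; rewrite ge0_fin_numE ?diam_ge0//; last by exists x.
  exact: le_lt_trans (U1 k) (ltry _).
have abV : `[a, b] `<=` \bigcup_k V k.
  move=> _ /abA[x Ax <-]; have [k _ Ukx] := AU _ Ax; exists k => //.
  rewrite /V; case: pselect => [H|]; last by case; exists x.
  case: (cid H) => y [Ay Uky] /=.
  rewrite in_itv/= -ler_distlC -lee_fin fineK ?fin//.
  by apply: le_trans (le_diam Uky Ukx); rewrite lee_fin lipf.
have leV k : (lebesgue_measure (V k) <= 2%:E * diam_pow s (U k))%E.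
  rewrite /V; case: pselect => [H|_]; last first.
    by rewrite measure0 mule_ge0// ?lee_fin// diam_pow_ge0.
  have U0 : U k !=set0 by case: H => x [_ ?]; exists x.
  rewrite lebesgue_measure_itv/=; case: ifPn => _; last first.
    by rewrite mule_ge0// ?lee_fin// diam_pow_ge0.
  rewrite -EFinB; set c := f _; set e := fine _.
  have -> : c + e - (c - e) = 2 * e by ring.
  rewrite EFinM lee_wpmul2l ?lee_fin// /e fineK ?fin//.
  by apply: diam_le_diam_pow => //; rewrite s0 ltW.
have : (lebesgue_measure (`[a, b] : set R) <=
    2%:E * \sum_(0 <= k <oo) diam_pow s (U k))%E.
  rewrite -nneseriesZl//; last by move=> k _; exact: diam_pow_ge0.
  apply: (@le_trans _ _ (\sum_(0 <= k <oo) lebesgue_measure (V k))%E).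
    exact: measure_sigma_subadditive.
  apply: lee_nneseries => k _ //.
rewrite lebesgue_measure_itv/= lte_fin ab -EFinB.
move=> H; rewrite -(@lee_pmul2l _ 2%:E)// ?lte_fin//.
apply: le_trans _ H; rewrite -EFinM lee_fin; lra.
Qed.

End covers.

(** * Arithmetic of compact intervals *)

Section kc_arithmetic.
Variable R : realType.

Lemma kc_ext (A B : Kc R) : (forall x, kc_set A x <-> kc_set B x) -> A = B.
Proof. by move=> AB; apply: Kc_eq; apply/seteqP; split=> x /AB. Qed.

Lemma set1_nonempty (c : R) : [set c] !=set0.
Proof. by exists c. Qed.

Lemma set1_convex (c : R) : convex_set ([set c] : set (convex_lmodType R^o)).
Proof.
move=> x y l; rewrite !inE => -> ->.
rewrite -[convex.conv _ _ _]/(l%:num * c + (1 - l%:num) * c); ring.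
Qed.

Definition kc_point (c : R) : Kc R :=
  MkKc (set1_nonempty c) (@compact_set1 R c) (@set1_convex c).

(** Nonemptiness is what makes [0 *: A] independent of [A]. *)
Lemma kc_scale0 (A B : Kc R) : (0 *: A = 0 *: B)%KC.
Proof.
by apply: kc_ext => x; split=> -[y _ <-];
  [have [z Bz] := kc_nonempty B|have [z Bz] := kc_nonempty A];
  exists z => //; rewrite !mul0r.
Qed.

Lemma kc_scaleK (l : R) (A : Kc R) : l != 0 -> (l *: (l^-1 *: A) = A)%KC.
Proof.
move=> l0; apply: kc_ext => x; split=> [[_ [y Ay <-] <-]|Ax].
  by rewrite mulVKf.
by exists (l^-1 * x); [exists x|rewrite mulVKf].
Qed.

(** [kc_sub] does not cancel, but [A - B + C - D] is the set of all
    [a - b + c - d], which is symmetric in the pairs [(A, B)] and [(C, D)]. *)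
Lemma kc_addB_swap (A B C D : Kc R) : (A - B + C - D = C - D + A - B)%KC.
Proof.
apply: kc_ext => x.
split=> -[_ [_ [a Aa [b Bb <-]] [c Cc <-]] [d Dd <-]].
  exists (c - d + a); last by exists b => //; ring.
  by exists (c - d); [exists c => //; exists d|exists a].
exists (c - d + a); last by exists b => //; ring.
by exists (c - d); [exists c => //; exists d|exists a].
Qed.

Lemma kc_scaleBr (l : R) (A B : Kc R) : (l *: (A - B) = l *: A - l *: B)%KC.
Proof.
apply: kc_ext => x; split.
  move=> [_ [a Aa [b Bb <-]] <-].
  by exists (l * a); [exists a|exists (l * b); [exists b|rewrite mulrBr]].
move=> [_ [a Aa <-] [_ [b Bb <-] <-]].
by exists (a - b); [exists a => //; exists b|rewrite mulrBr].
Qed.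

(** Together with [kc_scaleBr], it turns the right-hand side of the functional
    equation of the fractal function into the second coordinate of [W]. *)
Lemma kc_addBC (A B C : Kc R) : (A + (B - C) = B + A - C)%KC.
Proof.
apply: kc_ext => x; split.
  move=> [a Aa [_ [b Bb [c Cc <-]] <-]].
  exists (b + a); first by exists b => //; exists a.
  by exists c => //; ring.
move=> [_ [b Bb [a Aa <-]] [c Cc <-]].
exists a => //; exists (b - c); first by exists b => //; exists c.
by ring.
Qed.

End kc_arithmetic.

(** * Partition, fractal graph and the lower Lipschitz constant *)

Section partition.
Variables (R : realType) (N : nat) (u : nat -> R).

Lemma sum_ratio : (2 <= N)%N -> is_partition N u ->
  \sum_(1 <= i < N) Defs.ratio N u i = 1.
Proof.
move=> N2 hu; rewrite /Defs.ratio -mulr_suml telescope_sumr ?(ltnW N2)//.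
by rewrite divff// subr_eq0 gt_eqF// (partition_lt hu).
Qed.

Lemma partition_cover x : (2 <= N)%N -> u 1%N <= x <= u N ->
  exists2 j, (1 <= j < N)%N & u j <= x <= u j.+1.
Proof.
elim: N => // n IH; rewrite ltnS leq_eqVlt => /predU1P[<-|n2] /andP[ux xu].
  by exists 1%N => //; rewrite ux.
have [xn|nx] := leP x (u n); last first.
  by exists n; rewrite ?(ltnW nx)//; [rewrite ltnSn andbT ltnW|rewrite xu ltW].
have [|j /andP[j1 jn] xj] := IH n2; first by rewrite ux.
by exists j => //; rewrite j1 ltnW.
Qed.

End partition.

Section fractal.
Variables (R : realType) (N : nat) (u : nat -> R).
Variables (F S Fa : R -> Kc R) (alpha : R).
Hypothesis (N2 : (2 <= N)%N) (hu : is_partition N u).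

Let u1N : u 1%N < u N. Proof. exact: (partition_lt hu). Qed.

(** This is the functional equation of [Fa] at the point [L j x]. *)
Lemma W_graph j x : (1 <= j < N)%N -> is_fractal_function N u F S alpha Fa ->
  x \in `[u 1%N, u N] ->
  W N u F S alpha j (x, Fa x) = (L N u j x, Fa (L N u j x)).
Proof.
move=> jN [_ hFa] xI; rewrite [Fa (L _ _ _ _)](hFa j) ?LK//; last first.
  have r0 := ratio_gt0 hu jN.
  move: xI; rewrite !in_itv/= => /andP[ux xu].
  rewrite -[X in X <= _](L_first N u j) -[X in _ && (_ <= X)](L_last j hu N2).
  by rewrite /L !lerD2l !ler_pM2l// !lerD2r ux.
by rewrite /W/= kc_scaleBr kc_addBC.
Qed.

Lemma graph_self_similar : is_fractal_function N u F S alpha Fa ->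
  graph N u Fa `<=` \bigcup_(j : 'I_N.-1) (W N u F S alpha j.+1 @` graph N u Fa).
Proof.
move=> hFa _ [x xI <-].
have [j jN /andP[jx xj]] := partition_cover N2 xI.
have jE : j.-1.+1 = j by case/andP: jN => /prednK.
have jN1 : (j.-1 < N.-1)%N.
  by rewrite -ltnS jE; case: N N2 jN => //= n _ /andP[].
exists (Ordinal jN1) => //=; rewrite jE.
have r0 := ratio_gt0 hu jN.
have yI : Linv N u j x \in `[u 1%N, u N].
  rewrite in_itv/= /Linv lerDl divr_ge0 ?subr_ge0// ?(ltW r0)//=.
  rewrite -lerBrDl ler_pdivrMr// /ratio mulrC divfK ?subr_eq0 ?gt_eqF//.
  by rewrite lerD2r.
exists (Linv N u j x, Fa (Linv N u j x)); first by exists (Linv N u j x).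
by rewrite W_graph// LinvK.
Qed.

(** By continuity, [x |-> Hd (Fa x) (Fa (u 1))] attains a maximum on the segment,
    and any two values of [Fa] are within twice this maximum. *)
Lemma graph_bounded : {within `[u 1%N, u N], continuous Fa} ->
  exists2 d, 0 <= d &
    forall p q, graph N u Fa p -> graph N u Fa q -> D_G p q <= d.
Proof.
move=> cFa; pose A0 := Fa (u 1%N).
have cH : continuous (fun A : Kc R => Hd A A0).
  move=> A; apply/(@cvgrPdist_lt _ _ _ _ (nbhs_filter A)) => e e0.
  have := nbhsx_ballx A e e0; rewrite ballEmdist; apply: filterS => B /= AB.
  apply: le_lt_trans AB; rewrite -[mdist A B]/(Hd A B) ler_norml.
  have h1 := Hd_triangle B A A0; have h2 := Hd_triangle A B A0.
  by rewrite (Hd_sym B A) in h2; apply/andP; split; lra.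
have cg : {within `[u 1%N, u N], continuous (fun x => Hd (Fa x) A0)}.
  move=> x; apply: (@continuous_comp (subspace `[u 1%N, u N]) (Kc R) R Fa
      (fun A => Hd A A0) x).
      exact: cFa.
    exact: cH.
have [c _ hc] := EVT_max (ltW u1N) cg.
exists (u N - u 1%N + (Hd (Fa c) A0 + Hd (Fa c) A0)).
  by rewrite addr_ge0 ?(addr_ge0 (Hd_ge0 _ _) (Hd_ge0 _ _))// subr_ge0 ltW.
move=> _ _ [x xI <-] [y yI <-]; rewrite /D_G/=; apply: lerD.
  move: xI yI; rewrite /= !in_itv/= => /andP[? ?] /andP[? ?].
  by rewrite ler_norml; apply/andP; split; lra.
apply: le_trans (Hd_triangle A0 _ _) _.
by apply: lerD; [|rewrite Hd_sym]; apply: hc.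
Qed.

(** With [C x := F (L i x) - alpha *: S x], give the end [u 1] the set
    [alpha^-1 *: C (u N)] and the end [u N] the set [alpha^-1 *: C (u 1)].  The
    second coordinates of their images under [W i] are, up to the order of the
    terms, [C (u N) + C (u 1)] in both cases. *)
Lemma lower_ratio_le r i : (1 <= i < N)%N -> 0 < r ->
  (forall p q : graph_space R,
      p.1 \in `[u 1%N, u N] -> q.1 \in `[u 1%N, u N] ->
      r * D_G p q <= D_G (W N u F S alpha i p) (W N u F S alpha i q)) ->
  r <= Defs.ratio N u i.
Proof.
move=> iN r0 hW.
have u1I : u 1%N \in `[u 1%N, u N] by rewrite in_itv/= lexx ltW.
have uNI : u N \in `[u 1%N, u N] by rewrite in_itv/= lexx ltW.
have [a0|a0] := eqVneq alpha 0.
  (* For [alpha = 0] the map [W i] forgets the second coordinate, so it cannot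
     be bounded below by a positive multiple of the distance. *)
  have := hW (u 1%N, kc_point 0) (u 1%N, kc_point 1) u1I u1I.
  rewrite /W/= a0 (kc_scale0 (kc_point 0) (kc_point 1)) D_Gxx pmulr_rle0// => D0.
  have /D_G_positivity[] : D_G (u 1%N, kc_point 0) (u 1%N, kc_point 1) = 0.
    apply/eqP; rewrite eq_le D0.
    by rewrite -[D_G _ _]/(mdist (_ : graph_space R) _) mdist_ge0.
  move=> /(congr1 (fun A : set R => A 0))/= K01.
  have : (0 : R) = 1 by rewrite -K01.
  by move/eqP; rewrite eq_sym oner_eq0.
pose C x := (F (L N u i x) - alpha *: S x)%KC.
have := hW (u 1%N, alpha^-1 *: C (u N))%KC (u N, alpha^-1 *: C (u 1%N))%KC
  u1I uNI.
rewrite /W /C/= !kc_scaleK// {1}/D_G/= kc_addB_swap.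
rewrite [X in _ <= X]/D_G/= Hdxx addr0.
set h := Hd _ _; have h0 : 0 <= h := Hd_ge0 _ _.
have d0 : 0 < `|u 1%N - u N| by rewrite normr_gt0 subr_eq0 lt_eqF.
have -> : L N u i (u 1%N) - L N u i (u N) = Defs.ratio N u i * (u 1%N - u N).
  by rewrite /L; ring.
rewrite normrM gtr0_norm ?(ratio_gt0 hu iN)// => rD.
rewrite -(ler_pM2r d0); apply: le_trans rD.
by rewrite ler_pM2l// lerDl.
Qed.

End fractal.

Theorem theorem5p8 (R : realType) (N : nat) (u : nat -> R)
    (F S Fa : R -> Kc R) (alpha : R) (r rho : nat -> R) (tlow tup : R) :
  (2 <= N)%N ->
  is_partition N u ->
  {within `[u 1%N, u N], continuous F} ->
  {within `[u 1%N, u N], continuous S} ->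
  (S (u 1%N) - F (u 1%N))%KC = (S (u N) - F (u N))%KC ->
  -1 < alpha < 1 ->
  is_fractal_function N u F S alpha Fa ->
  (forall i, (1 <= i < N)%N -> 0 < r i /\ r i <= rho i /\ rho i < 1) ->
  (forall i, (1 <= i < N)%N ->
    forall p q : graph_space R,
      p.1 \in `[u 1%N, u N] -> q.1 \in `[u 1%N, u N] ->
      r i * D_G p q <= D_G (W N u F S alpha i p) (W N u F S alpha i q) /\
      D_G (W N u F S alpha i p) (W N u F S alpha i q) <= rho i * D_G p q) ->
  \sum_(1 <= i < N) r i `^ tlow = 1 ->
  \sum_(1 <= i < N) rho i `^ tup = 1 ->
  (tlow%:E <= hausdorff_dim (graph N u Fa))%E /\
  (hausdorff_dim (graph N u Fa) <= tup%:E)%E.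
Proof.
move=> N2 hu _ _ _ _ hFa r_rho hW sum_r sum_rho.
have r01 i : (1 <= i < N)%N -> 0 < r i < 1.
  by move=> /r_rho[-> [rr r1]] /=; exact: le_lt_trans r1.
have rho01 i : (1 <= i < N)%N -> 0 < rho i < 1.
  by move=> /r_rho[r0 [rr ->]]; rewrite (lt_le_trans r0 rr).
split.
  apply: le_trans (_ : (1%:E <= _)%E).
    rewrite lee_fin leNgt; apply/negP => t1.
    have := sum_powR_decr N2 r01 t1; apply/negP; rewrite -leNgt sum_r.
    rewrite -[X in _ <= X](sum_ratio N2 hu) !big_nat; apply: ler_sum => i iN.
    have [r0 _] := r_rho i iN; rewrite powRr1 ?(ltW r0)//.
    apply: (lower_ratio_le (F := F) (S := S) (alpha := alpha) N2 hu iN r0).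
    by move=> p q pI qI; case: (hW i iN p q pI qI).
  apply: (@hausdorff_dim_ge1 R (graph_space R) fst (u 1%N) (u N)).
  - exact: (partition_lt hu).
  - by move=> p q _ _; rewrite -[mdist p q]/(D_G p q) /D_G lerDl Hd_ge0.
  - by move=> x xI; exists (x, Fa x) => //; exists x.
(* A negative exponent would make each term of the sum, hence the sum, exceed
   its value at exponent 0, which is at least 1. *)
have tup0 : 0 <= tup.
  rewrite leNgt; apply/negP => t0.
  have := sum_powR_decr N2 rho01 t0; apply/negP; rewrite -leNgt sum_rho.
  case: N N2 {hu hFa r_rho hW sum_r sum_rho r01 rho01} => // n n2.
  rewrite big_nat_recl//= powRr0 lerDl sumr_ge0//= => i _; exact: powR_ge0.
have [d d0 graph_d] := graph_bounded N2 hu hFa.1.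
(* At the exponent [tup] itself the sums of the covers are only bounded, so the
   vanishing of the measure is obtained at [tup + e]. *)
apply/lee_addgt0Pr => e e0; apply: ereal_inf_lbound.
exists (tup + e) => //; split; first by rewrite addr_ge0// ltW.
have jN (j : 'I_N.-1) : (1 <= j.+1 < N)%N.
  by rewrite /= -[X in (_ < X)%N]prednK ?ltnS ?(ltnW N2)//.
apply: (attractor_hausdorff_measure0 _ d0 graph_d _ _ (graph_self_similar N2 hu hFa)
  (rho := fun j : 'I_N.-1 => rho j.+1)).
- by rewrite addr_ge0// ltW.
- by move=> j; have /andP[/ltW-> ->] := rho01 _ (jN j).
- move=> j _ _ [x xI <-] [y yI <-].
  by case: (hW _ (jN j) (x, Fa x) (y, Fa y) xI yI).
- have -> : \sum_(j < N.-1) rho j.+1 `^ (tup + e) =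
      \sum_(1 <= i < N) rho i `^ (tup + e) by rewrite big_add1 big_mkord.
  rewrite -sum_rho; apply: sum_powR_decr => //.
  by rewrite ltrDl.
Qed.
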